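(* Let $X_1^\sigma$ be a smooth special Peskine sixfold, and use a fixed isometry $H^6(X_1^\sigma,\mathbb{Z})\cong I_{22,2}$ to regard $\Lambda_{11}=\langle h^3,\pi\rangle$ as a sublattice of $I_{22,2}$. For each integer $d>0$ with $d\equiv0,2,6,8,10$, or $18\bmod 22$, the set of orbits $\mathcal{O}_d$ consists of a single element, which is represented by a lattice $M_d\supset\Lambda_{11}$ with Gram matrix (in a basis whose first two elements are $h^3,\pi$) \[ M_d\simeq\begin{pmatrix} 15 & 7 & a \\ 7 & 4 & b \\ a & b & c \end{pmatrix}, \] where (a) if $d\equiv0\bmod22$, then $(a,b,c)=(0,0,d/11)$; (b) if $d\equiv2\bmod22$, then $(a,b,c)=(3,1,(d+9)/11)$; (c) if $d\equiv6\bmod22$, then $(a,b,c)=(1,1,(d+5)/11)$; (d) if $d\equiv8\bmod22$, then $(a,b,c)=(2,1,(d+3)/11)$; (e) if $d\equiv10\bmod22$, then $(a,b,c)=(3,2,(d+12)/11)$; (f) if $d\equiv18\bmod22$, then $(a,b,c)=(1,0,(d+4)/11)$.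
   Context: $V_{10}$ is a $10$-dimensional complex vector space. For $\sigma\in\bigwedge^3V_{10}^\vee$, $X_1^\sigma=\{[V_1]\in\mathbb{P}(V_{10})\mid\operatorname{rank}\sigma(V_1,-,-)\le6\}$ is the Peskine variety and $X_6^\sigma=\{[V_6]\in\mathrm{Gr}(6,V_{10})\mid\sigma|_{V_6}=0\}$ the Debarre--Voisin variety. When $X_1^\sigma$ is smooth of dimension $6$, $H^6(X_1^\sigma,\mathbb{Z})$ with the intersection form is isometric to the odd unimodular lattice $I_{22,2}=\langle1\rangle^{22}\oplus\langle-1\rangle^{2}$. It contains the algebraic classes $h^3$ (cube of the hyperplane class) and $\pi$ (class of the Palatini threefold $X_1^\sigma\cap\mathbb{P}(V_6)$ for $[V_6]\in X_6^\sigma$), which span a primitive sublattice $\Lambda_{11}$ with Gram matrix $\begin{pmatrix} 15 & 7 \\ 7 & 4 \end{pmatrix}$. Its orthogonal complement $\Lambda_{\mathrm{van}}=\Lambda_{11}^\perp$ is an even lattice of discriminant $11$, isometric to the sign-reversal of $h_0^\perp\subset U^3\oplus E_8(-1)^2\oplus\langle-2\rangle$, where $h_0$ is a primitive vector of square $22$ and divisibility $2$; in particular it contains $U\oplus U$. ''Special of discriminant $d$'' in the smooth case implies there is a saturated rank $3$ sublattice $M_d$ of discriminant $d$ with $\Lambda_{11}\subset M_d\subset H^{3,3}(X_1^\sigma)\cap H^6(X_1^\sigma,\mathbb{Z})$. $\widetilde{\mathrm{O}}(\Lambda_{\mathrm{van}}):=\{g\in\mathrm{O}(I_{22,2})\mid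 g|_{\Lambda_{11}}=\mathrm{id}\}$. For each $d$, $\mathcal{O}_d$ is the set of orbits for the action of $\widetilde{\mathrm{O}}(\Lambda_{\mathrm{van}})$ on the set of primitive, positive definite, rank $3$ sublattices $M_d\subset I_{22,2}$ of discriminant (Gram determinant) $d$ containing $\Lambda_{11}$. *)

(* Defs.v *)
From HB Require Import structures.
From mathcomp Require Import all_boot all_order all_algebra.
From mathcomp Require Import boolp classical_sets functions.

Set Implicit Arguments.
Unset Strict Implicit.
Unset Printing Implicit Defensive.

Import Order.TTheory GRing.Theory Num.Theory.

Local Open Scope classical_set_scope.
Local Open Scope ring_scope.

(* A lattice is given by its Gram matrix G : 'M[int]_n, as a form on the      *)
(* row vectors 'rV[int]_n; its sublattices are sets of row vectors.           *)

Definition bform n (G : 'M[int]_n) (x y : 'rV[int]_n) : int :=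
  (x *m G *m y^T) 0 0.

Definition zspan k n (B : 'M[int]_(k, n)) : set 'rV[int]_n :=
  [set v | exists c : 'rV[int]_k, v = c *m B].

Definition zfree k n (B : 'M[int]_(k, n)) : Prop :=
  forall c : 'rV[int]_k, c *m B = 0 -> c = 0.

Definition zbasis k n (B : 'M[int]_(k, n)) (M : set 'rV[int]_n) : Prop :=
  zfree B /\ M = zspan B.

Definition gram k n (G : 'M[int]_n) (B : 'M[int]_(k, n)) : 'M[int]_k :=
  B *m G *m B^T.

(* M is a sublattice of rank k and discriminant d; the Gram determinant does  *)
(* not depend on the basis.                                                   *)
Definition sublattice_rank_disc n (G : 'M[int]_n) (k : nat) (d : int)
    (M : set 'rV[int]_n) : Prop :=
  exists2 B : 'M[int]_(k, n), zbasis B M & \det (gram G B) = d.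

Definition zsubgroup n (M : set 'rV[int]_n) : Prop :=
  M 0 /\ forall x y, M x -> M y -> M (x - y).

(* Primitive (saturated) sublattice.                                          *)
Definition saturated n (M : set 'rV[int]_n) : Prop :=
  forall (m : int) (v : 'rV[int]_n), m != 0 -> M (m *: v) -> M v.

Definition posdef n (G : 'M[int]_n) (M : set 'rV[int]_n) : Prop :=
  forall v, M v -> v != 0 -> 0 < bform G v v.

Definition orthogonal_of n (G : 'M[int]_n) (M : set 'rV[int]_n) :
    set 'rV[int]_n :=
  [set v | forall w, M w -> bform G v w = 0].

Definition isometric m n (G : 'M[int]_m) (M : set 'rV[int]_m)
    (H : 'M[int]_n) (N : set 'rV[int]_n) : Prop :=
  exists f : 'rV[int]_m -> 'rV[int]_n,
    [/\ set_bij M N f,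
        (forall x y, M x -> M y -> f (x + y) = f x + f y)
      & (forall x y, M x -> M y -> bform H (f x) (f y) = bform G x y)].

Definition primitive_vector n (v : 'rV[int]_n) : Prop :=
  forall (m : int) (w : 'rV[int]_n), v = m *: w -> m \is a GRing.unit.

(* The ideal of values of the form (v, -) is generated by m.                  *)
Definition divisibility n (G : 'M[int]_n) (v : 'rV[int]_n) (m : int) : Prop :=
  (forall w, (m %| bform G v w)%Z) /\ (exists w, bform G v w = m).

Definition mx_of_rows m n (s : seq (seq int)) : 'M[int]_(m, n) :=
  \matrix_(i < m, j < n) nth 0 (nth [::] s i) j.

Definition dsum m n (G : 'M[int]_m) (H : 'M[int]_n) : 'M[int]_(m + n) :=
  block_mx G 0 0 H.

Definition latI22_2 : 'M[int]_24 :=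
  diag_mx (\row_(i < 24) if (i < 22)%N then 1 else -1).

Definition latU : 'M[int]_2 := mx_of_rows 2 2 [:: [:: 0; 1]; [:: 1; 0]].

(* Positive definite; Cartan matrix in Bourbaki's numbering.                  *)
Definition latE8 : 'M[int]_8 := mx_of_rows 8 8
  [:: [::  2;  0; -1;  0;  0;  0;  0;  0];
      [::  0;  2;  0; -1;  0;  0;  0;  0];
      [:: -1;  0;  2; -1;  0;  0;  0;  0];
      [::  0; -1; -1;  2; -1;  0;  0;  0];
      [::  0;  0;  0; -1;  2; -1;  0;  0];
      [::  0;  0;  0;  0; -1;  2; -1;  0];
      [::  0;  0;  0;  0;  0; -1;  2; -1];
      [::  0;  0;  0;  0;  0;  0; -1;  2]].

(* U^3 + E8(-1)^2 + <-2>                                                      *)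
Definition latHK : 'M[int]_(2 + (2 + (2 + (8 + (8 + 1))))) :=
  dsum latU (dsum latU (dsum latU
    (dsum (- latE8) (dsum (- latE8) (- 2%:R)%:M)))).

Definition span2 (h p : 'rV[int]_24) : set 'rV[int]_24 := zspan (col_mx h p).

(* The lattice data carried by H^6(X, Z), for X a smooth Peskine sixfold,     *)
(* transported to I_{22,2} by the fixed isometry. The last field determines   *)
(* the isometry class of the vanishing lattice, and so implies that it is     *)
(* even, of discriminant 11, and contains U + U.                              *)
Record peskine_H6 := PeskineH6 {
  h3 : 'rV[int]_24;             (* cube of the hyperplane class *)
  pal : 'rV[int]_24;            (* class pi of the Palatini threefold *)
  hodge : set 'rV[int]_24;      (* H^{3,3} \cap H^6(X, Z) *)
  gram_h3_pal :
    gram latI22_2 (col_mx h3 pal) = mx_of_rows 2 2 [:: [:: 15; 7]; [:: 7; 4]];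
  saturated_Lambda11 : saturated (span2 h3 pal);
  zsubgroup_hodge : zsubgroup hodge;
  saturated_hodge : saturated hodge;
  hodge_Lambda11 : span2 h3 pal `<=` hodge;
  Lambda_van_HK : exists h0,
    [/\ primitive_vector h0, bform latHK h0 h0 = 22, divisibility latHK h0 2
      & isometric latI22_2 (orthogonal_of latI22_2 (span2 h3 pal))
                  (- latHK) (orthogonal_of latHK [set h0])]
}.

Definition Lambda11 (X : peskine_H6) : set 'rV[int]_24 :=
  span2 (h3 X) (pal X).

Definition special_of_disc (X : peskine_H6) (d : int) : Prop :=
  exists M : set 'rV[int]_24,
    [/\ sublattice_rank_disc latI22_2 3 d M, saturated M,
        Lambda11 X `<=` M & M `<=` hodge X].

Definition special (X : peskine_H6) : Prop := exists d, special_of_disc X d.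

(* Isometries act on row vectors on the right, v |-> v *m g.                  *)
Definition Otilde (X : peskine_H6) : set 'M[int]_24 :=
  [set g | [/\ g \in unitmx, g *m latI22_2 *m g^T = latI22_2
             & forall v, Lambda11 X v -> v *m g = v]].

Definition sublattices (X : peskine_H6) (d : int) : set (set 'rV[int]_24) :=
  [set M | [/\ sublattice_rank_disc latI22_2 3 d M, saturated M,
               posdef latI22_2 M & Lambda11 X `<=` M]].

Definition Otilde_orbit (X : peskine_H6) (M : set 'rV[int]_24) :
    set (set 'rV[int]_24) :=
  [set N | exists2 g, Otilde X g & N = [set v *m g | v in M]].

Definition orbits (X : peskine_H6) (d : int) : set (set (set 'rV[int]_24)) :=
  [set Otilde_orbit X M | M in sublattices X d].

Definition has_gram (X : peskine_H6) (M : set 'rV[int]_24) (a b c : int) :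
    Prop :=
  exists v : 'rV[int]_24,
    let B := col_mx (col_mx (h3 X) (pal X)) v in
    zbasis B M /\
    gram latI22_2 B =
      mx_of_rows 3 3 [:: [:: 15; 7; a]; [:: 7; 4; b]; [:: a; b; c]].

(* Main.v *)
Require Import Defs.
From mathcomp Require Import all_boot all_order all_algebra.
From mathcomp Require Import boolp classical_sets functions.
From mathcomp Require Import zify ring.

Import Order.TTheory GRing.Theory Num.Theory.

Local Open Scope classical_set_scope.
Local Open Scope ring_scope.

Set Implicit Arguments.
Unset Strict Implicit.

(** Write h, p for the two given classes, Lambda for their span and W for its
    orthogonal complement. Since Lambda is saturated, a rank 3 sublattice M
    containing it is Lambda + Z v, and v is determined up to sign and up to
    Lambda. Put a = (v, h), b = (v, p) and c = (v, v). The discriminant of M is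
    d = 11 c - (4 a^2 - 14 a b + 15 b^2), which is -4 (a + b)^2 modulo 11. The
    pairs of values taken by the vectors of Lambda on h and p are exactly those
    whose sum is divisible by 11; so d determines (a, b) up to the choice of v,
    and then it determines c. This gives the Gram matrices: v can be chosen with
    any prescribed (a, b) in the right class modulo 11 ([projection_class],
    [vector_of_sublattice]).

    Uniqueness of the orbit: if v and w have the same a, b, c, then v - w lies
    in W and v, w have the same square. As the ambient lattice is unimodular
    and M is saturated, each of v, w pairs to 1 with some vector of W
    ([saturated_primitive]). A version of Eichler's criterion
    ([eichler_criterion]) then yields an isometry fixing Lambda pointwise that
    sends v to w. The criterion needs W to be even and to contain U + U. Both
    facts are pulled back along the isometry from W to the sign-reversal of the
    complement of h0 in U^3 + E8(-1)^2 + <-2>: inside U^3, a change of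
    hyperbolic bases makes h0 orthogonal to two of the three planes
    ([hyperbolic_planes_orthogonal]).

    Existence: unimodularity and saturation of Lambda give a vector k with any
    prescribed pairings (a, b) with h and p ([exists_pairing]). A hyperbolic
    plane <e, f> in W is used to replace k by k + f + m e with k orthogonal to
    the plane. This pairs to 1 with e, so that Lambda + Z v is saturated, and
    its square runs, as m varies, over all integers of the parity of (k, k).
    That parity is the one of b, because W is even and Lambda + W has odd index
    ([sqr_parity]). Positivity of the resulting lattice is that of its three
    leading minors 15, 11 and d. *)

(** * Minimal nonzero values *)

(** Each descent below, as well as the fact that a subgroup of the integers is
    cyclic, starts from an element of [P] whose value [phi] is nonzero and
    smallest in absolute value. *)
Lemma least_nonzero_value T (P : set T) (phi : T -> int) :
  (forall x, P x -> phi x = 0) \/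
  exists x, [/\ P x, phi x != 0
    & forall y, P y -> `|phi y| < `|phi x| -> phi y = 0].
Proof.
pose attained k := `[< exists x, [/\ P x, phi x != 0 & `|phi x|%N = k] >].
have [ex_k|none] := pselect (exists k, attained k); [right | left] => [|x Px].
  case: (ex_minnP ex_k) => k /asboolP[x [Px nz xk]] kmin.
  exists x; split=> // y Py; apply: contraPeq => nzy.
  have /kmin : attained `|phi y|%N by apply/asboolP; exists y.
  by rewrite -xk; lia.
apply: contrapT => /eqP nz; apply: none; exists `|phi x|%N.
by apply/asboolP; exists x.
Qed.

(** * Bilinear forms and pointwise stabilizers *)

Lemma bform_delta n (H : 'M[int]_n) i j :
  bform H (delta_mx 0 i) (delta_mx 0 j) = H i j.
Proof. by rewrite /bform trmx_delta -rowE -colE !mxE. Qed.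

Lemma bform_opp n (H : 'M[int]_n) x y : bform (- H) x y = - bform H x y.
Proof. by rewrite /bform mulmxN mulNmx mxE. Qed.

Section Forms.
Variables (n : nat) (G : 'M[int]_n).
Local Notation "''[' x , y ]" := (bform G x y)
  (at level 0, format "''[' x ,  y ]").
Implicit Types (x y z : 'rV[int]_n) (m : int).

Lemma bformDl x y z : '[x + y, z] = '[x, z] + '[y, z].
Proof. by rewrite /bform !mulmxDl mxE. Qed.

Lemma bformDr x y z : '[z, x + y] = '[z, x] + '[z, y].
Proof. by rewrite /bform linearD mulmxDr mxE. Qed.

Lemma bformZl m x z : '[m *: x, z] = m * '[x, z].
Proof. by rewrite /bform -!scalemxAl mxE. Qed.

Lemma bformZr m x z : '[z, m *: x] = m * '[z, x].
Proof. by rewrite /bform linearZ /= -scalemxAr mxE. Qed.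

Lemma bformNl x z : '[- x, z] = - '[x, z].
Proof. by rewrite -scaleN1r bformZl mulN1r. Qed.

Lemma bformNr x z : '[z, - x] = - '[z, x].
Proof. by rewrite -scaleN1r bformZr mulN1r. Qed.

Lemma bform0l z : '[0, z] = 0.
Proof. by rewrite -(scale0r (0 : 'rV_n)) bformZl mul0r. Qed.

Lemma bform0r z : '[z, 0] = 0.
Proof. by rewrite -(scale0r (0 : 'rV_n)) bformZr mul0r. Qed.

Definition bformE :=
  (bformDl, bformDr, bformZl, bformZr, bformNl, bformNr, bform0l, bform0r).

Lemma bformC : G^T = G -> forall x y, '[x, y] = '[y, x].
Proof.
move=> symG x y; rewrite /bform -[in RHS]symG.
transitivity ((x *m G *m y^T)^T 0 0); first by rewrite [RHS]mxE.
by rewrite !trmx_mul trmxK mulmxA.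
Qed.

Lemma mulmx_bform k x y (A : 'M[int]_(1, k)) :
  x *m G *m y^T *m A = '[x, y] *: A.
Proof. by rewrite /bform {1}[x *m G *m y^T]mx11_scalar mul_scalar_mx. Qed.

Lemma gramE k (B : 'M[int]_(k, n)) i j : gram G B i j = '[row i B, row j B].
Proof.
rewrite /gram /bform -row_mul tr_row [RHS]mxE [LHS]mxE.
by apply: eq_bigr => l _; rewrite !mxE.
Qed.

Lemma isometry_of_bform (T : 'M[int]_n) :
  (forall x y, '[x *m T, y *m T] = '[x, y]) -> T *m G *m T^T = G.
Proof.
move=> isoT; apply/matrixP=> i j; rewrite -!bform_delta -isoT.
by rewrite /bform trmx_mul !mulmxA.
Qed.

Lemma bform_isometry (T : 'M[int]_n) x y :
  T *m G *m T^T = G -> '[x *m T, y *m T] = '[x, y].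
Proof. by move=> isoT; rewrite /bform trmx_mul !mulmxA -2!(mulmxA x) isoT. Qed.

(** The group of the theorem is the case where [G] is I_{22,2} and [S] is
    Lambda_11. *)
Definition pointwise_stabilizer (S : set 'rV[int]_n) : set 'M[int]_n :=
  [set g | [/\ g \in unitmx, g *m G *m g^T = G & forall v, S v -> v *m g = v]].

Definition equiv_under (S : set 'rV[int]_n) (v w : 'rV[int]_n) : Prop :=
  exists2 g, pointwise_stabilizer S g & v *m g = w.

Lemma equiv_under_refl S v : equiv_under S v v.
Proof.
exists 1%:M; last by rewrite mulmx1.
by split=> [||w _]; rewrite ?unitmx1 ?mulmx1 // mul1mx trmx1 mulmx1.
Qed.

Lemma pointwise_stabilizerM S g h : pointwise_stabilizer S g ->
  pointwise_stabilizer S h -> pointwise_stabilizer S (g *m h).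
Proof.
move=> [ug isog fixg] [uh isoh fixh]; split; first by rewrite unitmx_mul ug.
  by rewrite trmx_mul !mulmxA -2!(mulmxA g) isoh.
by move=> v Sv; rewrite mulmxA fixg ?fixh.
Qed.

Lemma pointwise_stabilizerV S g : pointwise_stabilizer S g ->
  pointwise_stabilizer S (invmx g).
Proof.
move=> [ug isog fixg]; split; first by rewrite unitmx_inv.
  by rewrite -{1}isog trmx_inv !mulmxA mulVmx // mul1mx mulmxK // unitmx_tr.
by move=> v Sv; rewrite -{1}(fixg v Sv) mulmxK.
Qed.

Lemma equiv_under_trans S u v w :
  equiv_under S u v -> equiv_under S v w -> equiv_under S u w.
Proof.
move=> [g Sg <-] [h Sh <-]; exists (g *m h); last by rewrite mulmxA.
exact: pointwise_stabilizerM.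
Qed.

Lemma equiv_under_sym S u v : equiv_under S u v -> equiv_under S v u.
Proof.
move=> [g Sg <-]; exists (invmx g); first exact: pointwise_stabilizerV.
by case: Sg => ug _ _; rewrite mulmxK.
Qed.

(** Two orthogonal copies of U, given by isotropic bases (e1, f1) and
    (e2, f2). *)
Definition hyperbolic_planes e1 f1 e2 f2 : Prop :=
  [/\ '[e1, e1] = 0, '[f1, f1] = 0, '[e2, e2] = 0, '[f2, f2] = 0 & '[e1, f1] = 1]
  /\ [/\ '[e2, f2] = 1, '[e1, e2] = 0, '[e1, f2] = 0, '[f1, e2] = 0
      & '[f1, f2] = 0].

End Forms.

(** * Eichler transvections *)

(** For e isotropic, a orthogonal to e and q = (a, a) / 2, this is the matrix of
    the Eichler transvection t(e, a) in its action on row vectors. The half q is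
    an argument because the integers are not closed under halving. *)
Definition transvection n (G : 'M[int]_n) (e a : 'rV[int]_n) (q : int) :
    'M[int]_n :=
  1%:M + G *m e^T *m a - G *m a^T *m e - q *: (G *m e^T *m e).

Section Transvections.
Variables (n : nat) (G : 'M[int]_n) (S : set 'rV[int]_n).
Local Notation "''[' x , y ]" := (bform G x y)
  (at level 0, format "''[' x ,  y ]").
Local Notation W := (orthogonal_of G S).
Local Notation "v ~ w" := (equiv_under G S v w) (at level 70).
Implicit Types (x y z e a : 'rV[int]_n) (m : int).
Hypothesis symG : G^T = G.

Lemma mul_transvection e a q x :
  x *m transvection G e a q = x + '[x, e] *: a - ('[x, a] + q * '[x, e]) *: e.
Proof.
rewrite /transvection !mulmxBr mulmxDr mulmx1 -scalemxAr !mulmxA !mulmx_bform.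
by rewrite scalerDl opprD !addrA scalerA.
Qed.

Lemma bform_transvection e a q x y :
    '[e, e] = 0 -> '[e, a] = 0 -> '[a, a] = 2 * q ->
  '[x *m transvection G e a q, y *m transvection G e a q] = '[x, y].
Proof.
move=> ee ea aa; have C := bformC symG.
rewrite !mul_transvection !bformE (C a e) (C e y) (C a y) ee ea aa; ring.
Qed.

Lemma transvectionK e a q : '[e, e] = 0 -> '[e, a] = 0 -> '[a, a] = 2 * q ->
  transvection G e a q *m transvection G e (- a) q = 1%:M.
Proof.
move=> ee ea aa; have C := bformC symG.
apply/row_matrixP=> i; rewrite row_mul row1 !rowE.
rewrite -[RHS]mulmx1; move: (delta_mx 0 i) => x.
rewrite mulmx1 !mul_transvection !bformE (C a e) ee ea aa.
by apply/rowP=> j; rewrite !mxE; ring.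
Qed.

(** A transvection built from two vectors of the complement of S only involves
    pairings with these two vectors, which vanish on S. *)
Lemma transvection_equiv e a q w :
    '[e, e] = 0 -> '[e, a] = 0 -> '[a, a] = 2 * q -> W e -> W a ->
  w ~ w + '[w, e] *: a - ('[w, a] + q * '[w, e]) *: e.
Proof.
move=> ee ea aa We Wa; exists (transvection G e a q); last exact: mul_transvection.
split.
- by have /mulmx1_unit[] := transvectionK ee ea aa.
- by apply: isometry_of_bform => x y; rewrite bform_transvection.
move=> v Sv; rewrite mul_transvection !(bformC symG v) (We v Sv) (Wa v Sv).
by rewrite mulr0 addr0 !scale0r subr0 addr0.
Qed.

Lemma equiv_under_orth v w x : v ~ w -> W x ->
  exists2 y, W y & '[y, w] = '[x, v].
Proof.
move=> [g [ug isog fixg] <-] Wx; exists (x *m g); last by rewrite bform_isometry.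
by move=> s Ss; rewrite -(fixg s Ss) bform_isometry // Wx.
Qed.

Lemma equiv_under_sqr v w : v ~ w -> '[w, w] = '[v, v].
Proof. by move=> [g [ug isog fixg] <-]; rewrite bform_isometry. Qed.

Lemma equiv_under_sub v w : v ~ w -> W (w - v).
Proof.
move=> [g [ug isog fixg] <-] s Ss.
by rewrite bformDl bformNl -{1}(fixg s Ss) bform_isometry // subrr.
Qed.

Lemma orthD x y : W x -> W y -> W (x + y).
Proof. by move=> Wx Wy s Ss; rewrite bformDl Wx // Wy. Qed.

Lemma orthZ m x : W x -> W (m *: x).
Proof. by move=> Wx s Ss; rewrite bformZl Wx // mulr0. Qed.

Lemma orthN x : W x -> W (- x).
Proof. by move=> Wx s Ss; rewrite bformNl Wx // oppr0. Qed.

End Transvections.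

Section Orbits.
Variables (n : nat) (G : 'M[int]_n) (S : set 'rV[int]_n).
Local Notation "''[' x , y ]" := (bform G x y)
  (at level 0, format "''[' x ,  y ]").
Local Notation W := (orthogonal_of G S).
Local Notation "v ~ w" := (equiv_under G S v w) (at level 70).
Implicit Types (x y z e a : 'rV[int]_n) (m : int).
Hypothesis symG : G^T = G.

(** The form in which transvections are used below: only pairings matter. *)
Lemma transvection_values w e a q :
    '[e, e] = 0 -> '[e, a] = 0 -> '[a, a] = 2 * q -> W e -> W a ->
  exists2 w', w ~ w' & forall y,
    '[w', y] = '[w, y] + '[w, e] * '[a, y] - ('[w, a] + q * '[w, e]) * '[e, y].
Proof.
move=> ee ea aa We Wa; eexists; first exact: (@transvection_equiv _ _ _ symG e a q).
by move=> y; rewrite bformDl bformNl bformDl !bformZl.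
Qed.

Lemma hyperbolic_planes_swap2 e1 f1 e2 f2 :
  hyperbolic_planes G e1 f1 e2 f2 -> hyperbolic_planes G e1 f1 f2 e2.
Proof.
by move=> [[? ? ? ? ?] [? ? ? ? ?]]; do 2!split; rewrite // bformC.
Qed.

Lemma hyperbolic_planes_swap1 e1 f1 e2 f2 :
  hyperbolic_planes G e1 f1 e2 f2 -> hyperbolic_planes G f1 e1 e2 f2.
Proof.
by move=> [[? ? ? ? ?] [? ? ? ? ?]]; do 2!split; rewrite // bformC.
Qed.

Lemma hyperbolic_planes_swap e1 f1 e2 f2 :
  hyperbolic_planes G e1 f1 e2 f2 -> hyperbolic_planes G e2 f2 e1 f1.
Proof.
by move=> [[? ? ? ? ?] [? ? ? ? ?]]; do 2!split; rewrite // bformC.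
Qed.

Lemma hyperbolic_planesE e1 f1 e2 f2 : hyperbolic_planes G e1 f1 e2 f2 ->
  (('[e1, e1] = 0) * ('[e1, f1] = 1) * ('[e1, e2] = 0) * ('[e1, f2] = 0)
  * ('[f1, e1] = 1) * ('[f1, f1] = 0) * ('[f1, e2] = 0) * ('[f1, f2] = 0)
  * ('[e2, e1] = 0) * ('[e2, f1] = 0) * ('[e2, e2] = 0) * ('[e2, f2] = 1)
  * ('[f2, e1] = 0) * ('[f2, f1] = 0) * ('[f2, e2] = 1) * ('[f2, f2] = 0))%type.
Proof.
by move=> [[? ? ? ? ?] [? ? ? ? ?]]; do !split; rewrite // bformC.
Qed.

Section Descent.
Variables e1 f1 e2 f2 : 'rV[int]_n.
Hypothesis hyp : hyperbolic_planes G e1 f1 e2 f2.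
Hypotheses (We1 : W e1) (Wf1 : W f1) (We2 : W e2) (Wf2 : W f2).

(** On the four pairings with e1, f1, e2, f2, transvections inside U + U act as
    elementary row and column operations on the 2 x 2 matrix with rows
    ((w, e1), (w, e2)) and (- (w, f2), (w, f1)). The two families below are the
    column operations; exchanging e2 and f2 turns them into row operations. *)
Lemma equiv_shear_e1 m w : exists2 w', w ~ w' &
  [/\ '[w', e1] = '[w, e1], '[w', f1] = '[w, f1] - m * '[w, f2],
      '[w', e2] = '[w, e2] + m * '[w, e1], '[w', f2] = '[w, f2]
    & forall y, '[e1, y] = 0 -> '[f2, y] = 0 -> '[w', y] = '[w, y]].
Proof.
have hypE := hyperbolic_planesE hyp.
have [|||||w' ww' w'E] := @transvection_values w e1 (m *: f2) 0.
- by rewrite hypE.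
- by rewrite bformE hypE mulr0.
- by rewrite !bformE hypE !mulr0.
- by [].
- exact: orthZ.
exists w' => //.
by split=> [||||y e1y f2y]; rewrite w'E !bformE ?hypE ?e1y ?f2y; ring.
Qed.

Lemma equiv_shear_f1 m w : exists2 w', w ~ w' &
  [/\ '[w', e1] = '[w, e1] - m * '[w, e2], '[w', f1] = '[w, f1],
      '[w', e2] = '[w, e2], '[w', f2] = '[w, f2] + m * '[w, f1]
    & forall y, '[f1, y] = 0 -> '[e2, y] = 0 -> '[w', y] = '[w, y]].
Proof.
have hypE := hyperbolic_planesE hyp.
have [|||||w' ww' w'E] := @transvection_values w f1 (m *: e2) 0.
- by rewrite hypE.
- by rewrite bformE hypE mulr0.
- by rewrite !bformE hypE !mulr0.
- by [].
- exact: orthZ.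
exists w' => //.
by split=> [||||y e1y f2y]; rewrite w'E !bformE ?hypE ?e1y ?f2y; ring.
Qed.

(** Besides the four hyperbolic pairings, an arbitrary vector y orthogonal to
    e1, f1 and e2 can be fed into the pairing with e1. Adding m e2 to y does not
    change its square, and provides the multiple of (w, e2) used to reduce the
    result. *)
Lemma equiv_shear_f1_orth m q y w : W y -> '[y, y] = 2 * q ->
    '[y, e1] = 0 -> '[y, f1] = 0 -> '[y, e2] = 0 ->
  exists2 w', w ~ w' &
    '[w', e1] = '[w, e1] - ('[w, y] + m * '[w, e2] + q * '[w, f1]).
Proof.
move=> Wy yy ye1 yf1 ye2; have hypE := hyperbolic_planesE hyp.
have [|||||w' ww' w'E] := @transvection_values w f1 (y + m *: e2) q.
- by rewrite hypE.
- by rewrite !bformE hypE (bformC symG) yf1 mulr0.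
- by rewrite !bformE hypE (bformC symG e2) ye2 yy !mulr0 !addr0.
- by [].
- by apply: orthD => //; apply: orthZ.
by exists w' => //; rewrite w'E !bformE ?hypE ye1; ring.
Qed.

(** A representative of an orbit at which the descent has stopped. *)
Definition minimal_pairing e v : Prop := '[v, e] != 0 /\
  forall w, v ~ w -> `|'[w, e]| < `|'[v, e]| -> '[w, e] = 0.

Lemma minimal_pairing_equiv e v w :
  minimal_pairing e v -> v ~ w -> '[w, e] = '[v, e] -> minimal_pairing e w.
Proof.
move=> [nz minv] vw eq_we; split=> [|u wu]; rewrite eq_we //.
by apply: minv; apply: equiv_under_trans wu.
Qed.

(** One step of the Euclidean algorithm on (v, e1) and (v, e2) would otherwise
    produce a smaller nonzero pairing with e1. *)
Lemma minimal_dvd_e2 v : minimal_pairing e1 v -> ('[v, e1] %| '[v, e2])%Z.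
Proof.
move=> [nzA minv].
have [w1 vw1 [A1 _ C1 _ _]] := equiv_shear_e1 (- ('[v, e2] %/ '[v, e1])%Z) v.
have C1E : '[w1, e2] = ('[v, e2] %% '[v, e1])%Z by rewrite C1 /modz; ring.
apply/dvdz_mod0P/eqP; apply: contraT => nzr.
(* With this quotient the new pairing with e1 lies between 1 and (w1, e2), so
   it cannot vanish. *)
have [w2 w12 [A2 _ _ _ _]] := equiv_shear_f1 (('[v, e1] - 1) %/ '[w1, e2])%Z w1.
have A2E : '[w2, e1] = (('[v, e1] - 1) %% '[w1, e2])%Z + 1.
  by rewrite A2 A1 /modz; ring.
have r_ge0 := modz_ge0 '[v, e2] nzA.
have r_lt := ltz_mod '[v, e2] nzA.
rewrite -C1E in r_ge0 r_lt nzr.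
have s_ge0 := modz_ge0 ('[v, e1] - 1) nzr.
have s_lt := ltz_mod ('[v, e1] - 1) nzr.
have := minv w2 (equiv_under_trans vw1 w12).
rewrite A2E; lia.
Qed.

End Descent.

Section Primitive.
Variables e1 f1 e2 f2 : 'rV[int]_n.
Hypothesis hyp : hyperbolic_planes G e1 f1 e2 f2.
Hypotheses (We1 : W e1) (Wf1 : W f1) (We2 : W e2) (Wf2 : W f2).
Hypothesis evenW : forall x, W x -> exists q, '[x, x] = 2 * q.

Lemma minimal_dvd_f2 v : minimal_pairing e1 v -> ('[v, e1] %| '[v, f2])%Z.
Proof. by apply: minimal_dvd_e2 (hyperbolic_planes_swap2 hyp) _ _ _ _ _. Qed.

(** Once (v, e2) has been cleared, (v, f1) can be added to (v, f2) without
    moving (v, e1), and the divisibility of the pairing with f2 applies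
    again. *)
Lemma minimal_dvd_f1 v : minimal_pairing e1 v -> ('[v, e1] %| '[v, f1])%Z.
Proof.
move=> minv.
have dvdC := minimal_dvd_e2 hyp We1 Wf1 We2 Wf2 minv.
have dvdD := minimal_dvd_f2 minv.
have [w1 vw1 [A1 B1 C1 D1 _]] :=
  equiv_shear_e1 hyp We1 Wf2 (- ('[v, e2] %/ '[v, e1])%Z) v.
have C1E : '[w1, e2] = 0 by rewrite C1 mulNr divzK // subrr.
have [w2 w12 [A2 _ _ D2 _]] := equiv_shear_f1 hyp Wf1 We2 1 w1.
have A2E : '[w2, e1] = '[v, e1] by rewrite A2 C1E A1 mulr0 subr0.
have vw2 := equiv_under_trans vw1 w12.
have := minimal_dvd_f2 (minimal_pairing_equiv minv vw2 A2E).
rewrite A2E D2 D1 mul1r B1 mulNr opprK rpredDl //.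
by rewrite rpredDr // dvdz_mull.
Qed.

(** Moving (v, e2) to the value (v, e1) makes the pairing with e1 reducible
    modulo itself while (v, y) is being added to it; by minimality the residue
    vanishes. Evenness of the complement is what makes y usable in a
    transvection. *)
Lemma minimal_dvd_orth v y : minimal_pairing e1 v -> W y ->
    '[y, e1] = 0 -> '[y, f1] = 0 -> '[y, e2] = 0 -> '[y, f2] = 0 ->
  ('[v, e1] %| '[v, y])%Z.
Proof.
move=> minv Wy ye1 yf1 ye2 yf2; have C := bformC symG.
have dvdB := minimal_dvd_f1 minv.
have dvdC := minimal_dvd_e2 hyp We1 Wf1 We2 Wf2 minv.
have dvdD := minimal_dvd_f2 minv.
have [q yy] := evenW Wy.
have [w1 vw1 [A1 B1 C1 D1 yE]] :=
  equiv_shear_e1 hyp We1 Wf2 (1 - ('[v, e2] %/ '[v, e1])%Z) v.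
have C1E : '[w1, e2] = '[v, e1].
  by rewrite C1 mulrBl divzK // mul1r addrC subrK.
have {}yE : '[w1, y] = '[v, y] by apply: yE; rewrite C.
pose t := '[v, e1] - ('[v, y] + q * '[w1, f1]).
have [w2 w12 A2] :=
  equiv_shear_f1_orth hyp Wf1 We2 (t %/ '[v, e1])%Z w1 Wy yy ye1 yf1 ye2.
have A2E : '[w2, e1] = (t %% '[v, e1])%Z.
  by rewrite A2 A1 C1E yE /modz /t; ring.
case: minv => nzA minv.
have r_ge0 := modz_ge0 t nzA; have r_lt := ltz_mod t nzA.
have t0 : (t %% '[v, e1])%Z = 0.
  by rewrite -A2E; apply: minv (equiv_under_trans vw1 w12) _; rewrite A2E; lia.
move/dvdz_mod0P: t0; rewrite /t rpredBl ?dvdzz // rpredDr //.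
by rewrite dvdz_mull // B1 rpredB ?dvdz_mull.
Qed.

Lemma hyperbolic_decomp x : W x -> exists y,
  [/\ W y, [/\ '[y, e1] = 0, '[y, f1] = 0, '[y, e2] = 0 & '[y, f2] = 0] &
  x = '[x, f1] *: e1 + '[x, e1] *: f1 + '[x, f2] *: e2 + '[x, e2] *: f2 + y].
Proof.
have hypE := hyperbolic_planesE hyp => Wx.
pose z := '[x, f1] *: e1 + '[x, e1] *: f1 + '[x, f2] *: e2 + '[x, e2] *: f2.
exists (x - z); split; last by rewrite addrC subrK.
  by apply: orthD => //; apply: orthN; do !apply: orthD; apply: orthZ.
by split; rewrite /z !bformE !hypE; ring.
Qed.

(** A minimal pairing divides all pairings with the complement of S, since the
    latter splits as U + U and its orthogonal. *)
Lemma minimal_pairing_unit v : minimal_pairing e1 v ->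
  (exists2 x, W x & '[v, x] = 1) -> '[v, e1] = 1 \/ '[v, e1] = - 1.
Proof.
move=> minv [x Wx vx].
have [y [Wy [ye1 yf1 ye2 yf2] xE]] := hyperbolic_decomp Wx.
have : ('[v, e1] %| '[v, x])%Z.
  rewrite xE !bformE !rpredD ?dvdz_mull //.
  - exact: minimal_dvd_f1.
  - exact: (minimal_dvd_e2 hyp).
  - exact: minimal_dvd_f2.
  - exact: minimal_dvd_orth.
rewrite vx dvdz1 => /eqP; lia.
Qed.

(** Starting point of the descent: some pairing of v with the complement is
    nonzero, and transvections carry it to the pairing with e1. *)
Lemma pairing_neq0 v : (exists2 x, W x & '[v, x] = 1) ->
  exists2 w, v ~ w & '[w, e1] != 0.
Proof.
move=> [x Wx vx].
have hyp' := hyperbolic_planes_swap2 hyp.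
have [A0|] := eqVneq '[v, e1] 0; last by exists v => //; apply: equiv_under_refl.
have [C0|C0] := eqVneq '[v, e2] 0; last first.
  have [w vw [A _ _ _ _]] := equiv_shear_f1 hyp Wf1 We2 1 v.
  by exists w => //; rewrite A A0 mul1r sub0r oppr_eq0.
have [D0|D0] := eqVneq '[v, f2] 0; last first.
  have [w vw [A _ _ _ _]] := equiv_shear_f1 hyp' Wf1 Wf2 1 v.
  by exists w => //; rewrite A A0 mul1r sub0r oppr_eq0.
have [B0|B0] := eqVneq '[v, f1] 0; last first.
  have [w vw [A _ _ D _]] := equiv_shear_f1 hyp Wf1 We2 1 v.
  have [u wu [A' _ _ _ _]] := equiv_shear_f1 hyp' Wf1 Wf2 1 w.
  exists u; first exact: equiv_under_trans wu.
  by rewrite A' A D A0 C0 D0 !mul1r subrr !add0r oppr_eq0.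
have [y [Wy [ye1 yf1 ye2 yf2] xE]] := hyperbolic_decomp Wx.
have vy : '[v, y] = 1 by rewrite -vx xE !bformE A0 B0 C0 D0; ring.
have [q yy] := evenW Wy.
have [w vw A] := equiv_shear_f1_orth hyp Wf1 We2 0 v Wy yy ye1 yf1 ye2.
by exists w => //; rewrite A A0 B0 C0 vy !mulr0 !addr0.
Qed.

Lemma pairing_eq1 v : (exists2 x, W x & '[v, x] = 1) ->
  exists2 w, v ~ w & '[w, e1] = 1.
Proof.
move=> vprim.
have [w0 vw0 nz0] := pairing_neq0 vprim.
have [v0|[w [vw nz minw]]] :=
    least_nonzero_value [set w | v ~ w] ((bform G)^~ e1).
  by rewrite (v0 w0 vw0) eqxx in nz0.
have {}minw : minimal_pairing e1 w.
  by split=> // u wu; apply: minw; apply: equiv_under_trans wu.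
have wprim : exists2 x, W x & '[w, x] = 1.
  have [x Wx vx] := vprim; have [y Wy yw] := equiv_under_orth vw Wx.
  by exists y; rewrite // bformC // yw bformC.
have [|A] := minimal_pairing_unit minw wprim; first by exists w.
(* Here (w, e1) = -1: first give e2 the pairing -2, then subtract it from the
   pairing with e1. *)
have [w1 ww1 [A1 _ C1 _ _]] := equiv_shear_e1 hyp We1 Wf2 ('[w, e2] + 2) w.
have [w2 w12 [A2 _ _ _ _]] := equiv_shear_f1 hyp Wf1 We2 1 w1.
exists w2; last by rewrite A2 A1 C1 A; ring.
exact: equiv_under_trans vw (equiv_under_trans ww1 w12).
Qed.

(** Both vectors are moved to vectors v1, w1 that pair to 1 with e1. Their
    difference a lies in the complement of S and is orthogonal to e1, so the
    transvection t(e1, a) is available; it sends v1 to w1 up to a multiple of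
    e1, and this multiple is zero because v1 and w1 have the same square. *)
Lemma eichler_criterion v w : W (v - w) -> '[v, v] = '[w, w] ->
    (exists2 x, W x & '[v, x] = 1) -> (exists2 x, W x & '[w, x] = 1) ->
  v ~ w.
Proof.
move=> Wvw eq_sqr /pairing_eq1[v1 vv1 v1e] /pairing_eq1[w1 ww1 w1e].
have [hypE C] := (hyperbolic_planesE hyp, bformC symG).
suff v1w1 : v1 ~ w1.
  exact: equiv_under_trans vv1 (equiv_under_trans v1w1 (equiv_under_sym ww1)).
pose a := w1 - v1.
have Wa : W a.
  have -> : a = (w1 - w) - (v1 - v) - (v - w).
    by rewrite /a; apply/rowP=> j; rewrite !mxE; ring.
  apply: orthD (orthN Wvw); apply: orthD (orthN (equiv_under_sub vv1)).
  exact: equiv_under_sub.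
have [q aa] := evenW Wa.
have ea : '[e1, a] = 0 by rewrite /a !bformE (C e1) (C e1 v1) v1e w1e subrr.
have e0 : '[e1, e1] = 0 by rewrite hypE.
have v1a : v1 + a = w1 by rewrite addrC subrK.
clearbody a.
have [g Sg v1g] := transvection_equiv symG v1 e0 ea aa We1 Wa.
exists g => //; rewrite v1g v1e scale1r mulr1.
suff -> : '[v1, a] + q = 0 by rewrite scale0r subr0.
have : '[v1 + a, v1 + a] = '[v1, v1].
  by rewrite v1a (equiv_under_sqr ww1) (equiv_under_sqr vv1).
rewrite !bformE (C a v1) aa; lia.
Qed.
End Primitive.
End Orbits.

(** * Hyperbolic planes orthogonal to a vector *)

Section Adapt.
Variables (n : nat) (G : 'M[int]_n) (v : 'rV[int]_n).
Local Notation "''[' x , y ]" := (bform G x y)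
  (at level 0, format "''[' x ,  y ]").
Hypothesis symG : G^T = G.

Definition orthogonal4 (y a b c d : 'rV[int]_n) : Prop :=
  [/\ '[y, a] = 0, '[y, b] = 0, '[y, c] = 0 & '[y, d] = 0].

Lemma hyperbolic_planes_shear e1 f1 e2 f2 m :
  hyperbolic_planes G e1 f1 e2 f2 ->
  hyperbolic_planes G e1 (f1 - m *: e2) e2 (f2 + m *: e1).
Proof.
move=> hyp; have hypE := hyperbolic_planesE symG hyp.
by do 2!split; rewrite ?bformE ?hypE; ring.
Qed.

(** The Euclidean algorithm again, now changing the hyperbolic bases instead of
    the vector: when the first nonzero pairing is smallest, the pairings with
    the second plane can be reduced to zero. The second conclusion is the
    form in which the new bases lying in the span of the old ones is used. *)
Lemma hyperbolic_planes_adapt e1 f1 e2 f2 : hyperbolic_planes G e1 f1 e2 f2 ->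
  exists a b c d : 'rV[int]_n,
    [/\ hyperbolic_planes G a b c d,
        forall y, orthogonal4 y e1 f1 e2 f2 -> orthogonal4 y a b c d,
        '[v, c] = 0 & '[v, d] = 0].
Proof.
move=> hyp.
pose adm a b c d := hyperbolic_planes G a b c d /\
  forall y, orthogonal4 y e1 f1 e2 f2 -> orthogonal4 y a b c d.
have adm0 : adm e1 f1 e2 f2 by [].
have adm1 a b c d : adm a b c d -> adm b a c d.
  by move=> [habcd oabcd]; split=> [|y /oabcd[]//]; apply: hyperbolic_planes_swap1.
have adm2 a b c d : adm a b c d -> adm a b d c.
  by move=> [habcd oabcd]; split=> [|y /oabcd[]//]; apply: hyperbolic_planes_swap2.
have adms a b c d : adm a b c d -> adm c d a b.
  by move=> [habcd oabcd]; split=> [|y /oabcd[]//]; apply: hyperbolic_planes_swap.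
have admS m a b c d : adm a b c d -> adm a (b - m *: c) c (d + m *: a).
  move=> [habcd oabcd]; split=> [|y /oabcd[ya yb yc yd]].
    exact: hyperbolic_planes_shear.
  by split; rewrite ?bformE ?ya ?yb ?yc ?yd ?mulr0 ?oppr0 ?addr0.
have [allz|[a [[b [c [d abcd]]] nz min_a]]] := least_nonzero_value
    [set a | exists b c d, adm a b c d] (bform G v).
  have v0 a b c d : adm a b c d -> '[v, a] = 0.
    by move=> abcd; apply: allz; exists b, c, d.
  exists e1, f1, e2, f2; split=> //; first exact: (v0 _ _ _ _ (adms _ _ _ _ adm0)).
  exact: (v0 _ _ _ _ (adm1 _ _ _ _ (adms _ _ _ _ adm0))).
have minz a' b' c' d' : adm a' b' c' d' -> `|'[v, a']| < `|'[v, a]| -> '[v, a'] = 0.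
  by move=> abcd'; apply: min_a; exists b', c', d'.
have reduce b' c' d' : adm a b' c' d' ->
    '[v, d' + - ('[v, d'] %/ '[v, a])%Z *: a] = 0.
  move=> abcd'; have := admS (- ('[v, d'] %/ '[v, a])%Z) _ _ _ _ abcd'.
  move/adms/adm1/minz; apply; rewrite !bformE.
  have r_ge0 := modz_ge0 '[v, d'] nz; have r_lt := ltz_mod '[v, d'] nz.
  by move: r_ge0 r_lt; rewrite /modz; lia.
have abcd1 := admS (- ('[v, d] %/ '[v, a])%Z) _ _ _ _ abcd.
have d0 := reduce _ _ _ abcd.
have abcd2 := admS (- ('[v, c] %/ '[v, a])%Z) _ _ _ _ (adm2 _ _ _ _ abcd1).
have c0 := reduce _ _ _ (adm2 _ _ _ _ abcd1).
have [hyp2 orth2] := adm2 _ _ _ _ abcd2.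
by do 4![eexists]; split; [exact: hyp2 | exact: orth2 | |].
Qed.
End Adapt.

(** The pairings of v with U + U + U are concentrated on the first plane by
    adapting planes one and two, then planes one and three. *)
Lemma hyperbolic_planes_orthogonal n (G : 'M[int]_n) (v : 'rV[int]_n)
    e1 f1 e2 f2 e3 f3 : G^T = G ->
    hyperbolic_planes G e1 f1 e2 f2 -> hyperbolic_planes G e1 f1 e3 f3 ->
    hyperbolic_planes G e2 f2 e3 f3 ->
  exists a b c d : 'rV[int]_n, hyperbolic_planes G a b c d /\ orthogonal4 G v a b c d.
Proof.
move=> symG h12 h13 h23.
have [a [b [c [d [habcd oabcd vc vd]]]]] := hyperbolic_planes_adapt v symG h12.
have E13 := hyperbolic_planesE symG h13; have E23 := hyperbolic_planesE symG h23.
have Eabcd := hyperbolic_planesE symG habcd.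
have [e3a e3b e3c e3d] : orthogonal4 G e3 a b c d.
  by apply: oabcd; split; rewrite ?E13 ?E23.
have [f3a f3b f3c f3d] : orthogonal4 G f3 a b c d.
  by apply: oabcd; split; rewrite ?E13 ?E23.
have hab3 : hyperbolic_planes G a b e3 f3.
  by do 2!split; rewrite ?Eabcd ?E13 // bformC.
have [a' [b' [c' [d' [habcd' oabcd' vc' vd']]]]] :=
  hyperbolic_planes_adapt v symG hab3.
have [_ _ cc' cd'] : orthogonal4 G c a' b' c' d'.
  by apply: oabcd'; split; rewrite ?Eabcd // bformC.
have [_ _ dc' dd'] : orthogonal4 G d a' b' c' d'.
  by apply: oabcd'; split; rewrite ?Eabcd // bformC.
have E' := hyperbolic_planesE symG habcd'.
by exists c, d, c', d'; split=> //; do 2!split; rewrite ?Eabcd ?E'.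
Qed.

(** * Even lattices and the lattice U^3 + E8(-1)^2 + <-2> *)

(** Encoding evenness by one half of the Gram matrix gives symmetry at the same
    time, and is stable under opposites and orthogonal sums. *)
Definition even_form n (G : 'M[int]_n) : Prop := exists T, G = T + T^T.

Lemma even_form_sym n (G : 'M[int]_n) : even_form G -> G^T = G.
Proof. by move=> [T ->]; rewrite linearD /= trmxK addrC. Qed.

Lemma even_form_sqr n (G : 'M[int]_n) x : even_form G -> exists q, bform G x x = 2 * q.
Proof.
move=> [T ->]; exists (bform T x x); rewrite mulr_natl mulr2n.
rewrite [LHS]/bform mulmxDr mulmxDl mxE; congr (_ + _).
transitivity ((x *m T *m x^T)^T 0 0); last by rewrite mxE.
by rewrite !trmx_mul trmxK mulmxA.
Qed.

Lemma even_formN n (G : 'M[int]_n) : even_form G -> even_form (- G).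
Proof. by move=> [T ->]; exists (- T); rewrite opprD linearN. Qed.

Lemma even_form_dsum m n (G : 'M[int]_m) (H : 'M[int]_n) :
  even_form G -> even_form H -> even_form (dsum G H).
Proof.
move=> [T ->] [U ->]; exists (block_mx T 0 0 U).
by rewrite tr_block_mx add_block_mx !trmx0 !addr0.
Qed.

Lemma even_formI n (G : 'M[int]_n) (T : 'M[int]_n) :
  (forall i j, G i j == T i j + T j i) -> even_form G.
Proof.
by move=> GT; exists T; apply/matrixP => i j; rewrite !mxE; apply/eqP.
Qed.

Lemma even_latU : even_form latU.
Proof.
apply: (@even_formI _ _ (\matrix_(i, j) (i < j)%:R)) => i j.
by rewrite !mxE; case: i j => [[|[|//]] ?] [[|[|//]] ?].
Qed.

Lemma even_latE8 : even_form latE8.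
Proof.
pose T : 'M[int]_8 := \matrix_(i, j)
  if (i < j)%N then latE8 i j else (i == j)%:R.
apply: (@even_formI _ _ T) => i j; rewrite !mxE.
by case: i j => [[|[|[|[|[|[|[|[|//]]]]]]]] ?] [[|[|[|[|[|[|[|[|//]]]]]]]] ?].
Qed.

Lemma even_latHK : even_form latHK.
Proof.
have even2 : even_form ((- 2%:R)%:M : 'M[int]_1).
  by exists (- 1)%:M; rewrite tr_scalar_mx -raddfD.
have evenE8 := even_formN even_latE8; have evenU := even_latU.
by do 5!(apply: even_form_dsum => //).
Qed.

Lemma bform_dsum m n (G : 'M[int]_m) (H : 'M[int]_n) x1 x2 y1 y2 :
  bform (dsum G H) (row_mx x1 x2) (row_mx y1 y2) = bform G x1 y1 + bform H x2 y2.
Proof.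
rewrite /bform /dsum mul_row_block tr_row_mx mul_row_col !mulmx0 addr0 add0r.
by rewrite mxE.
Qed.

Lemma latHK_planes : exists e1 f1 e2 f2 e3 f3,
  [/\ hyperbolic_planes latHK e1 f1 e2 f2, hyperbolic_planes latHK e1 f1 e3 f3
    & hyperbolic_planes latHK e2 f2 e3 f3].
Proof.
pose e : 'rV[int]_2 := delta_mx 0 0; pose f : 'rV[int]_2 := delta_mx 0 1.
pose u1 (x : 'rV[int]_2) := row_mx x (0 : 'rV[int]_(2 + (2 + (8 + (8 + 1))))).
pose u2 (x : 'rV[int]_2) :=
  row_mx (0 : 'rV[int]_2) (row_mx x (0 : 'rV[int]_(2 + (8 + (8 + 1))))).
pose u3 (x : 'rV[int]_2) := row_mx (0 : 'rV[int]_2) (row_mx (0 : 'rV[int]_2)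
   (row_mx x (0 : 'rV[int]_(8 + (8 + 1))))).
exists (u1 e), (u1 f), (u2 e), (u2 f), (u3 e), (u3 f).
by do 3!split; rewrite /u1 /u2 /u3 /latHK !bform_dsum ?bform0l ?bform0r ?bform_delta ?mxE.
Qed.

(** * Sublattices, bases and saturation *)

Lemma principal_values n (W : set 'rV[int]_n) (phi : 'rV[int]_n -> int) :
    W !=set0 ->
    (forall m x y, W x -> W y -> W (x - m *: y)) ->
    (forall m x y, phi (x - m *: y) = phi x - m * phi y) ->
  exists2 x, W x & forall y, W y -> (phi x %| phi y)%Z.
Proof.
move=> [x0 Wx0] subW phiB.
have [phi0|[x [Wx nz min_x]]] := least_nonzero_value W phi.
  by exists x0 => // y Wy; rewrite phi0.
exists x => // y Wy; apply/dvdz_mod0P.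
have yE : phi (y - (phi y %/ phi x)%Z *: x) = (phi y %% phi x)%Z by rewrite phiB.
have r_ge0 := modz_ge0 (phi y) nz; have r_lt := ltz_mod (phi y) nz.
by rewrite -yE; apply: min_x; [exact: subW | rewrite yE ger0_norm].
Qed.

Lemma zspanZB k n (B : 'M[int]_(k, n)) m x y :
  zspan B x -> zspan B y -> zspan B (x - m *: y).
Proof.
by move=> [c ->] [c' ->]; exists (c - m *: c'); rewrite mulmxBl scalemxAl.
Qed.

Lemma zspan_row k n (B : 'M[int]_(k, n)) i : zspan B (row i B).
Proof. by exists (delta_mx 0 i); rewrite rowE. Qed.

Lemma zspan_mul k l n (A : 'M[int]_(k, n)) (B : 'M[int]_(l, n)) :
  zspan A `<=` zspan B -> exists C, A = C *m B.
Proof.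
move=> sAB; have /fin_all_exists[c cE] i : exists c, row i A = c *m B.
  exact: sAB (zspan_row A i).
exists (\matrix_i c i); apply/row_matrixP => i.
by rewrite row_mul rowK.
Qed.

(** Over the integers a spanning family with as many elements as a basis is a
    basis, and the change of basis has determinant 1 or -1. *)
Lemma zspan_det_gram k n (G : 'M[int]_n) (B B' : 'M[int]_(k, n)) M :
    zbasis B M -> M = zspan B' ->
  zbasis B' M /\ \det (gram G B') = \det (gram G B).
Proof.
move=> [freeB ->] eqBB'.
have [P B'P] : exists P, B' = P *m B by apply: zspan_mul; rewrite eqBB'.
have [Q BQ] : exists Q, B = Q *m B' by apply: zspan_mul; rewrite eqBB'.
have QP : Q *m P = 1%:M.
  apply/row_matrixP=> i; apply/eqP; rewrite -subr_eq0; apply/eqP/freeB.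
  by rewrite mulmxBl -!row_mul -mulmxA -B'P -BQ mul1mx subrr.
have PQ := mulmx1C QP.
split; first split=> // c cB'; rewrite ?eqBB' //.
  rewrite -[c]mulmx1 -PQ mulmxA (freeB (c *m P)) ?mul0mx //.
  by rewrite -mulmxA -B'P.
have -> : gram G B' = P *m gram G B *m P^T by rewrite B'P /gram trmx_mul !mulmxA.
have /intUnitRing.unitzPl/pred2P detP : \det Q * \det P = 1.
  by rewrite -det_mulmx QP det1.
have detP2 : \det P * \det P = 1.
  by case: detP => ->.
by rewrite !det_mulmx det_tr mulrAC detP2 mul1r.
Qed.

Lemma zfree_of_gram k n (G : 'M[int]_n) (B : 'M[int]_(k, n)) :
  \det (gram G B) != 0 -> zfree B.
Proof.
move=> nz c cB; apply/eqP; apply: contraNT nz => nzc; apply/det0P.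
by exists c => //; rewrite /gram !mulmxA cB !mul0mx.
Qed.

(** The function phi, which maps c to the determinant of C with the row c added,
    vanishes exactly on the coordinates of vectors of the span of A, by
    saturation. Its
    values form a subgroup of the integers, and a generator of this subgroup is
    attained at a vector completing A to a basis. *)
Lemma saturated_extend k n (A : 'M[int]_(k, n)) (B : 'M[int]_(k + 1, n)) :
    zfree A -> saturated (zspan A) -> zspan A `<=` zspan B ->
  zfree B -> exists v : 'rV[int]_n, zspan B = zspan (col_mx A v).
Proof.
move=> freeA satA sAB freeB; have [C AC] := zspan_mul sAB.
pose phi (c : 'rV[int]_(k + 1)) := \det (col_mx C c).
have phiB m x y : phi (x - m *: y) = phi x - m * phi y.
  rewrite -[phi x]mul1r -mulNr /phi.
  apply: (@determinant_multilinear _ _ _ _ _ (rshift k 0)).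
  - by rewrite !rowKd !row_id scale1r scaleNr.
  - by rewrite !row'Kd ![row' _ _]flatmx0.
  - by rewrite !row'Kd ![row' _ _]flatmx0.
have ker c : phi c = 0 -> zspan A (c *m B).
  move/eqP/det0P=> [u nzu]; rewrite -[u]hsubmxK mul_row_col => uC.
  have [g gE] : exists g, rsubmx u = g%:M by exists (rsubmx u 0 0); apply: mx11_scalar.
  have relA : lsubmx u *m A + g *: (c *m B) = 0.
    by rewrite AC mulmxA scalemxAl -mul_scalar_mx -gE -mulmxDl uC mul0mx.
  have nzg : g != 0.
    apply: contraNneq nzu => g0; rewrite -[u]hsubmxK gE g0.
    rewrite (freeA (lsubmx u)) ?raddf0 ?row_mx0 //.
    by rewrite g0 scale0r addr0 in relA.
  apply: (satA g) => //; exists (- lsubmx u).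
  by apply/eqP; rewrite mulNmx -addr_eq0 addrC relA.
have [|//|c0 _ c0P] := @principal_values _ setT phi _ _ phiB; first by exists 0.
(* If phi vanished, the k + 1 vectors of B would lie in the span of the k
   vectors of A. *)
have nz0 : phi c0 != 0.
  apply/eqP => phi0.
  have [Y BY] : exists Y, B = Y *m A.
    apply: zspan_mul => _ [c ->]; apply: ker.
    by have := c0P c I; rewrite phi0 dvd0z => /eqP.
  have YC : Y *m C = 1%:M.
    apply/row_matrixP=> i; apply/eqP; rewrite -subr_eq0; apply/eqP/freeB.
    by rewrite mulmxBl -!row_mul -mulmxA -AC -BY mul1mx subrr.
  by have := mulmx1_min YC; rewrite addn1 ltnn.
exists (c0 *m B); apply/seteqP; split=> [_ [c ->]|_ [c ->]]; last first.
  rewrite -[c]hsubmxK mul_row_col [rsubmx c]mx11_scalar mul_scalar_mx AC.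
  exists (lsubmx c *m C + rsubmx c 0 0 *: c0).
  by rewrite mulmxDl mulmxA scalemxAl.
have /dvdzP[q cE] := c0P c I.
have [|a aE] := ker (c - q *: c0); first by rewrite phiB cE subrr.
exists (row_mx a q%:M); rewrite mul_row_col mul_scalar_mx -aE.
by rewrite mulmxBl scalemxAl subrK.
Qed.

(** A unimodular lattice is its own dual: a vector whose pairings are all
    divisible by m represents m times an integral functional. *)
Lemma unimodular_divisor n (G : 'M[int]_n) v m : G \in unitmx ->
  (forall x, (m %| bform G x v)%Z) -> exists y, v = m *: y.
Proof.
move=> uG dvd_v.
pose q : 'cV[int]_n := \col_i divz (bform G (delta_mx 0 i) v) m.
exists (invmx G *m q)^T; apply: trmx_inj; rewrite linearZ /= trmxK scalemxAr.
rewrite -[LHS](mulKmx uG); congr (_ *m _); apply/colP=> i.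
rewrite !mxE mulrC divzK //.
rewrite /bform -mulmxA -rowE !mxE.
by apply: eq_bigr => j _; rewrite !mxE.
Qed.

Lemma zspan_col_mx1 k n (A : 'M[int]_(k, n)) (v x : 'rV[int]_n) :
  zspan (col_mx A v) x <-> exists2 u, zspan A u & exists g, x = u + g *: v.
Proof.
split=> [[c ->]|[_ [c ->] [g ->]]].
  rewrite -[c]hsubmxK mul_row_col [rsubmx c]mx11_scalar mul_scalar_mx.
  by exists (lsubmx c *m A); [exists (lsubmx c) | exists (rsubmx c 0 0)].
by exists (row_mx c g%:M); rewrite mul_row_col mul_scalar_mx.
Qed.

Lemma span2P h p v : span2 h p v <-> exists a b, v = a *: h + b *: p.
Proof.
split=> [[c ->]|[a [b ->]]].
  rewrite -[c]hsubmxK mul_row_col [rsubmx c]mx11_scalar [lsubmx c]mx11_scalar.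
  by rewrite !mul_scalar_mx; do 2!eexists.
by exists (row_mx a%:M b%:M); rewrite mul_row_col !mul_scalar_mx.
Qed.

Lemma latI22_2_sym : latI22_2^T = latI22_2.
Proof. exact: tr_diag_mx. Qed.

Lemma latI22_2_unit : latI22_2 \in unitmx.
Proof.
suff /mulmx1_unit[] : latI22_2 *m latI22_2 = 1%:M by [].
rewrite mulmx_diag -diag_const_mx; congr diag_mx; apply/rowP=> i.
by rewrite !mxE; case: ifP.
Qed.

(** * The vanishing lattice *)

Lemma gram_col_mx3 (G : 'M[int]_24) h p v :
  gram G (col_mx (col_mx h p) v) = mx_of_rows 3 3
    [:: [:: bform G h h; bform G h p; bform G h v];
        [:: bform G p h; bform G p p; bform G p v];
        [:: bform G v h; bform G v p; bform G v v]].
Proof.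
have rowE3 (i : 'I_(1 + 1 + 1)) :
    row i (col_mx (col_mx h p) v) = nth 0 [:: h; p; v] i.
  case: (split_ordP i) => [j|j] ->; last by rewrite rowKd [j]ord1 row_id.
  rewrite rowKu.
  by case: (split_ordP j) => k ->; rewrite ?rowKu ?rowKd [k]ord1 row_id.
apply/matrixP=> i j; rewrite (gramE G) !rowE3 mxE.
by case: i j => [[|[|[|//]]] ?] [[|[|[|//]]] ?].
Qed.

Lemma det_gram3 (a b c : int) :
  \det (mx_of_rows 3 3 [:: [:: 15; 7; a]; [:: 7; 4; b]; [:: a; b; c]])
  = 11 * c - (4 * a ^+ 2 - 14 * a * b + 15 * b ^+ 2).
Proof.
rewrite (expand_det_row _ 0) !big_ord_recl big_ord0 /cofactor.
rewrite !(expand_det_row _ 0) !big_ord_recl !big_ord0 /cofactor !det_mx11 !mxE /=.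
ring.
Qed.

Section VanishingLattice.
Variable X : peskine_H6.
Local Notation G := latI22_2.
Local Notation "''[' x , y ]" := (bform G x y)
  (at level 0, format "''[' x ,  y ]").
Local Notation h := (h3 X).
Local Notation p := (pal X).
Local Notation W := (orthogonal_of G (span2 h p)).
Let symG := latI22_2_sym.
Let C := bformC symG.

Lemma Lambda11E :
  (('[h, h] = 15) * ('[h, p] = 7) * ('[p, h] = 7) * ('[p, p] = 4))%type.
Proof.
have hpE (i j : 'I_(1 + 1)) :=
  congr1 (fun M : 'M[int]_(1 + 1) => M i j) (gram_h3_pal X).
pose i0 : 'I_(1 + 1) := lshift 1 0; pose i1 : 'I_(1 + 1) := rshift 1 0.
have := (hpE i0 i0, hpE i0 i1, hpE i1 i0, hpE i1 i1).
by rewrite !gramE !mxE /= !rowKu !rowKd !row_id => -[[[-> ->] ->] ->].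
Qed.

Lemma Lambda_vanP x : W x <-> '[x, h] = 0 /\ '[x, p] = 0.
Proof.
split=> [Wx|[xh xp] _ /span2P[a [b ->]]].
  by split; apply: Wx; apply/span2P; [exists 1, 0 | exists 0, 1];
    rewrite scale1r scale0r ?addr0 ?add0r.
by rewrite !bformE xh xp !mulr0.
Qed.

Lemma Lambda_van_even x : W x -> exists q, '[x, x] = 2 * q.
Proof.
have [h0 [_ _ _ [f [_ _ isof]]]] := Lambda_van_HK X => Wx.
have [q qE] := even_form_sqr (f x) (even_formN even_latHK).
by exists q; rewrite -(isof _ _ Wx Wx).
Qed.

(** If (a, b) is a hyperbolic basis, then (a, - b) is one for the opposite
    form. *)
Lemma Lambda_van_planes : exists e1 f1 e2 f2,
  hyperbolic_planes G e1 f1 e2 f2 /\ [/\ W e1, W f1, W e2 & W f2].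
Proof.
have [h0 [_ _ _ [f [[_ _ surjf] _ isof]]]] := Lambda_van_HK X.
have symHK := even_form_sym even_latHK.
have [u1 [v1 [u2 [v2 [u3 [v3 [h12 h13 h23]]]]]]] := latHK_planes.
have [a [b [c [d [habcd [h0a h0b h0c h0d]]]]]] :=
  hyperbolic_planes_orthogonal h0 symHK h12 h13 h23.
have lift u : bform latHK h0 u = 0 -> exists2 x, W x & f x = u.
  by move=> h0u; apply: surjf => _ ->; rewrite bformC.
have lifted x y : W x -> W y -> '[x, y] = - bform latHK (f x) (f y).
  by move=> Wx Wy; rewrite -(isof _ _ Wx Wy) bform_opp.
have [e1 We1 e1E] := lift a h0a.
have [|f1 Wf1 f1E] := lift (- b); first by rewrite bformNr h0b oppr0.
have [e2 We2 e2E] := lift c h0c.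
have [|f2 Wf2 f2E] := lift (- d); first by rewrite bformNr h0d oppr0.
have E := hyperbolic_planesE symHK habcd.
exists e1, f1, e2, f2; split=> //.
by do 2!split; rewrite lifted // ?e1E ?f1E ?e2E ?f2E ?(bformNl, bformNr) ?bformNr E.
Qed.

(** The vector 11 x is the sum of an element of Lambda_11 and of an element y of
    its complement. As 11 is odd and (y, y) is even, (x, x) has the parity of
    the square of the former, which is 11 (4 a^2 - 14 a b + 15 b^2). *)
Lemma sqr_parity x : exists q, '[x, x] = '[x, p] + 2 * q.
Proof.
set a := '[x, h]; set b := '[x, p].
have E := Lambda11E.
(* The adjugate of the Gram matrix of h, p has rows (4, -7) and (-7, 15). *)
pose y := 11 *: x - (4 * a - 7 * b) *: h - (15 * b - 7 * a) *: p.
have Wy : W y by apply/Lambda_vanP; rewrite /y !bformE !E -/a -/b; split; ring.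
have [q] := Lambda_van_even Wy.
rewrite /y !bformE !E (C h x) (C p x) -/a -/b => eq_q.
have [r br] : exists r, b * b = b + 2 * r.
  have [k [->|->]] : exists k, b = 2 * k \/ b = 2 * k + 1.
    by exists (b %/ 2)%Z; lia.
  - by exists (2 * k * k - k); ring.
  - by exists (2 * k * k + k); ring.
exists (q - 60 * '[x, x] + 22 * a * a - 77 * a * b + 82 * b * b + r).
move: eq_q br; lia.
Qed.

(** The vectors of Lambda_11 already realize all pairs whose sum is divisible by
    11. As 11 is prime, it is enough to find one x0 with (x0, h + p) prime to
    11; otherwise h + p would be divisible by 11, against saturation. *)
Lemma exists_pairing a b : exists x, '[x, h] = a /\ '[x, p] = b.
Proof.
have E := Lambda11E.
have [x0 nz0] : exists x, ~~ (11 %| '[x, h + p])%Z.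
  apply: contrapT => none.
  have [x|y hpy] := unimodular_divisor (v := h + p) (m := 11) latI22_2_unit.
    by apply: contrapT => /negP nz; apply: none; exists x.
  have : span2 h p y.
    apply: (@saturated_Lambda11 X 11) => //; rewrite -hpy; apply/span2P.
    by exists 1, 1; rewrite !scale1r.
  case/span2P=> a' [b' yE].
  have := congr1 (bform G^~ h) hpy; have := congr1 (bform G^~ p) hpy.
  rewrite yE !bformE !E; lia.
have [u [w uw]] : exists u w : int, u * '[x0, h + p] = 1 + 11 * w.
  have cop : coprimez '[x0, h + p] 11.
    by rewrite coprimez_sym coprimezE prime_coprime // -dvdzE.
  have /coprimezP[[u w] /= uw] := cop.
  by exists u, (- w); rewrite mulrN mulrC; lia.
rewrite bformDr in uw.
(* For r, Y integers, (4 r - Y) h + (2 Y - 7 r) p has pairings 11 r - Y with h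
   and Y with p. *)
pose t : int := (a + b) * u.
pose r : int := - (a + b) * w.
pose Y : int := b - t * '[x0, p].
exists (t *: x0 + (4 * r - Y) *: h + (2 * Y - 7 * r) *: p).
rewrite !bformE !E /Y /r /t; split; last by ring.
transitivity (a + (a + b) * (u * ('[x0, h] + '[x0, p]) - 1 - 11 * w)).
  by rewrite !mulrDr; ring.
by rewrite uw; ring.
Qed.
End VanishingLattice.

(** * Rank 3 sublattices containing Lambda_11 *)

Section SpecialSublattices.
Variable X : peskine_H6.
Local Notation G := latI22_2.
Local Notation "''[' x , y ]" := (bform G x y)
  (at level 0, format "''[' x ,  y ]").
Local Notation h := (h3 X).
Local Notation p := (pal X).
Local Notation W := (orthogonal_of G (span2 h p)).
Local Notation adjoin v := (zspan (col_mx (col_mx h p) (v : 'rV[int]_24))).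
Let symG := latI22_2_sym.
Let C := bformC symG.
Let E := Lambda11E X.

Lemma span2ZD m x y : span2 h p x -> span2 h p y -> span2 h p (x - m *: y).
Proof. exact: zspanZB. Qed.

Lemma zfree_span2 v g :
  zfree (col_mx (col_mx h p) v) -> span2 h p (g *: v) -> g = 0.
Proof.
move=> freeB [c gv]; have := freeB (row_mx c (- g)%:M).
rewrite mul_row_col mul_scalar_mx scaleNr gv subrr => /(_ erefl).
move/(congr1 rsubmx); rewrite row_mxKr => /matrixP/(_ 0 0).
by rewrite !mxE /= => /eqP; rewrite oppr_eq0 => /eqP.
Qed.

(** Let m generate the ideal of pairings of v with the complement, and let xh,
    xp be vectors with pairings (1, 0) and (0, 1) with h and p. Subtracting from
    any y its components along xh and xp shows that m divides all pairings of
    v - s h - t p, where s = (v, xh) and t = (v, xp). So this vector is m y0,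
    with y0 in the sublattice by saturation; comparing coefficients of v, m is a
    unit. *)
Lemma saturated_primitive v :
    zfree (col_mx (col_mx h p) v) -> saturated (adjoin v) ->
  exists2 x, W x & '[v, x] = 1.
Proof.
move=> freeB satM.
have [xh [xhh xhp]] := exists_pairing X 1 0.
have [xp [xph xpp]] := exists_pairing X 0 1.
have [|||x Wx dvd_x] := @principal_values _ W (bform G v).
- by exists 0 => s _; rewrite bform0l.
- by move=> m y z Wy Wz; rewrite -scaleNr; apply/orthD/orthZ.
- by move=> m y z; rewrite !bformE.
pose m := '[v, x]; pose s := '[v, xh]; pose t := '[v, xp].
have [y|y yE] :=
  unimodular_divisor (v := v - (s *: h + t *: p)) (m := m) latI22_2_unit.
  have -> : '[y, v - (s *: h + t *: p)] =
      '[v, y - ('[y, h] *: xh + '[y, p] *: xp)].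
    by rewrite !bformE (C y v) /s /t; ring.
  apply/dvd_x/Lambda_vanP; rewrite !bformE xhh xhp xph xpp; split; ring.
have Lst : span2 h p (s *: h + t *: p) by apply/span2P; exists s, t.
have : adjoin v (m *: y).
  apply/zspan_col_mx1; exists (0 - 1 *: (s *: h + t *: p)).
    by apply: span2ZD => //; exists 0; rewrite mul0mx.
  by exists 1; rewrite -yE sub0r !scale1r addrC.
have [m0 _|nzm /(satM _ _ nzm)] := eqVneq m 0.
  have /eqP : (1 : int) = 0.
    apply: (zfree_span2 freeB); rewrite scale1r.
    by move: yE; rewrite m0 scale0r => /eqP; rewrite subr_eq0 => /eqP ->.
  by [].
move/zspan_col_mx1 => [u Lu [g yu]].
have mg : 1 - m * g = 0.
  apply: (zfree_span2 freeB).
  have -> : (1 - m * g) *: v = (s *: h + t *: p) - (- m) *: u.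
    move/eqP: yE; rewrite subr_eq yu => /eqP vE.
    rewrite scalerBl scale1r {1}vE; apply/rowP=> j; rewrite !mxE; ring.
  exact: span2ZD.
exists (g *: x); first exact: orthZ.
by rewrite bformZr -/m; lia.
Qed.

(** Pairing with x splits off the coefficient of v, which reduces saturation to
    that of Lambda_11. *)
Lemma sublattice_of_vector v a b c d :
    '[v, h] = a -> '[v, p] = b -> '[v, v] = c ->
    (exists2 x, W x & '[v, x] = 1) -> 0 < d -> d = 11 * c - (4 * a ^+ 2 - 14 * a * b + 15 * b ^+ 2) ->
  sublattices X d (adjoin v) /\ has_gram X (adjoin v) a b c.
Proof.
move=> vh vp vv [x Wx vx] d_gt0 dE.
have gramv : gram G (col_mx (col_mx h p) v) =
    mx_of_rows 3 3 [:: [:: 15; 7; a]; [:: 7; 4; b]; [:: a; b; c]].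
  by rewrite gram_col_mx3 !E !(C _ v) vh vp vv.
have detv : \det (gram G (col_mx (col_mx h p) v)) = d.
  by rewrite gramv det_gram3 dE.
have basisv : zbasis (col_mx (col_mx h p) v) (adjoin v).
  by split=> //; apply: (@zfree_of_gram _ _ G); rewrite detv; lia.
split; last by exists v; split.
have sub y : span2 h p y -> adjoin v y.
  by move=> Ly; apply/zspan_col_mx1; exists y => //; exists 0; rewrite scale0r addr0.
split.
- by exists (col_mx (col_mx h p) v).
- move=> m w nzm /zspan_col_mx1[u Lu [g mw]].
  have mwx : m * '[w, x] = g.
    by rewrite -bformZl mw !bformE vx (C u) (Wx u Lu); ring.
  apply/zspan_col_mx1; exists (w - '[w, x] *: v); last first.
    by exists '[w, x]; rewrite subrK.
  apply: (@saturated_Lambda11 X m) => //.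
  by rewrite scalerBr mw scalerA mwx addrK.
- move=> y /zspan_col_mx1[_ /span2P[s [t ->]] [g yE]] nzy.
  (* Completing the square, with leading minors 15, 11 and d; 165 = 15 * 11
     clears the denominators. *)
  have : 165 * '[y, y] = 11 * (15 * s + 7 * t + a * g) ^+ 2
      + (11 * t + (15 * b - 7 * a) * g) ^+ 2 + 15 * d * g ^+ 2.
    by rewrite yE !bformE !E !(C _ v) vh vp vv dE; ring.
  have sq1 := sqr_ge0 (15 * s + 7 * t + a * g).
  have sq2 := sqr_ge0 (11 * t + (15 * b - 7 * a) * g).
  have [g0|nzg] := eqVneq g 0; last first.
    have : 0 < d * g ^+ 2 by rewrite mulr_gt0 // exprn_even_gt0.
    lia.
  have [t0|nzt] := eqVneq t 0; last first.
    have : 0 < t ^+ 2 by rewrite exprn_even_gt0.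
    rewrite g0; lia.
  have nzs : s != 0.
    by apply: contraNneq nzy => s0; rewrite yE s0 t0 g0 !scale0r !addr0.
  have : 0 < s ^+ 2 by rewrite exprn_even_gt0.
  rewrite g0 t0; lia.
- exact: sub.
Qed.

Lemma adjoin_shift v u e :
  span2 h p u -> e * e = 1 -> adjoin v = adjoin (e *: v + u).
Proof.
move=> Lu ee; apply/seteqP.
split=> y /zspan_col_mx1[w Lw [g ->]]; apply/zspan_col_mx1.
  exists (w - (g * e) *: u); first exact: span2ZD.
  exists (g * e); rewrite scalerDr scalerA -mulrA ee mulr1.
  by rewrite (addrC (g *: v)) addrA subrK.
exists (w - (- g) *: u); first exact: span2ZD.
by exists (g * e); rewrite scalerDr scalerA scaleNr opprK addrA addrAC.
Qed.

(** Modulo 11 the equal discriminants are -4 (a + b)^2 and -4 (a0 + b0)^2, and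
    11 is prime. The unit e is the sign to be given to v. *)
Lemma projection_class a b c a0 b0 c0 :
    11 * c - (4 * a ^+ 2 - 14 * a * b + 15 * b ^+ 2)
    = 11 * c0 - (4 * a0 ^+ 2 - 14 * a0 * b0 + 15 * b0 ^+ 2) :> int ->
  exists e r : int, e * e = 1 /\ (a0 - e * a) + (b0 - e * b) = 11 * r.
Proof.
move=> eq_d.
have : (11 %| (a + b - (a0 + b0)) * (a + b + (a0 + b0)))%Z.
  have -> : (a + b - (a0 + b0)) * (a + b + (a0 + b0)) =
      11 * ( 3 * c - 3 * c0 - (a ^+ 2 - a0 ^+ 2) + 4 * (a * b - a0 * b0)
           - 4 * (b ^+ 2 - b0 ^+ 2)) by lia.
  exact: dvdz_mulr.
rewrite !dvdzE abszM Euclid_dvdM // -!dvdzE => /orP[] /dvdzP[r rE].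
  by exists 1, (- r); split=> //; lia.
by exists (- 1), r; split=> //; lia.
Qed.

(** The generator v of the sublattice modulo Lambda_11 is corrected by a sign
    and by an element u of Lambda_11 so as to have the prescribed pairings; the
    discriminant then forces its square. *)
Lemma vector_of_sublattice M d a0 b0 c0 :
    sublattices X d M ->
    d = 11 * c0 - (4 * a0 ^+ 2 - 14 * a0 * b0 + 15 * b0 ^+ 2) ->
  exists v, [/\ M = adjoin v, '[v, h] = a0, '[v, p] = b0, '[v, v] = c0
    & exists2 x, W x & '[v, x] = 1].
Proof.
move=> [[B basisB detB] satM _ sLM] dE.
have disc v : M = adjoin v ->
    zfree (col_mx (col_mx h p) v) /\
    d = 11 * '[v, v] - (4 * '[v, h] ^+ 2 - 14 * '[v, h] * '[v, p]
                        + 15 * '[v, p] ^+ 2).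
  move=> Mv; have [[freev _] detv] := zspan_det_gram G basisB Mv.
  split=> //; rewrite -detB -detv gram_col_mx3 !E !(C _ v); exact: det_gram3.
have [v Mv] : exists v : 'rV[int]_24, M = adjoin v.
  have [freeB MB] := basisB; rewrite MB.
  apply: (@saturated_extend (1 + 1) _ (col_mx h p) B); rewrite -?MB //.
    apply: (@zfree_of_gram _ _ G); rewrite gram_h3_pal.
    rewrite (expand_det_row _ 0) !big_ord_recl big_ord0 /cofactor.
    by rewrite !det_mx11 !mxE.
  exact: saturated_Lambda11.
have [_ dv] := disc v Mv.
have [e [r [ee er]]] := projection_class (etrans (esym dv) dE).
pose Y := b0 - e * '[v, p].
(* The pairings of u with h and p are 11 r - Y and Y. *)
pose u := (4 * r - Y) *: h + (2 * Y - 7 * r) *: p.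
have Lu : span2 h p u by apply/span2P; do 2!eexists.
have Mw : M = adjoin (e *: v + u) by rewrite -adjoin_shift.
set w := e *: v + u in Mw.
have [freew dw] := disc w Mw.
have wh : '[w, h] = a0 by rewrite /w /u !bformE !E /Y; lia.
have wp : '[w, p] = b0 by rewrite /w /u !bformE !E /Y; lia.
exists w; split=> //; last by apply: saturated_primitive; rewrite -?Mw.
by move: dw; rewrite dE wh wp; lia.
Qed.

(** The last condition is met by making the pairing with e1 equal to 1, and the
    coefficient of e1 adjusts the square. *)
Lemma exists_vector a b c : (2 %| c - b)%Z ->
  exists v, [/\ '[v, h] = a, '[v, p] = b, '[v, v] = c
    & exists2 x, W x & '[v, x] = 1].
Proof.
move=> /dvdzP[r cE].
have [e1 [f1 [e2 [f2 [hyp [We1 Wf1 _ _]]]]]] := Lambda_van_planes X.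
have hypE := hyperbolic_planesE symG hyp.
have [k [kh kp]] := exists_pairing X a b.
have [/Lambda_vanP[eh ep] /Lambda_vanP[fh fp]] := (We1, Wf1).
pose k0 := k - ('[k, f1] *: e1 + '[k, e1] *: f1).
have k0h : '[k0, h] = a by rewrite /k0 !bformE kh eh fh; ring.
have k0p : '[k0, p] = b by rewrite /k0 !bformE kp ep fp; ring.
have k0e : '[k0, e1] = 0 by rewrite /k0 !bformE !hypE; ring.
have k0f : '[k0, f1] = 0 by rewrite /k0 !bformE !hypE; ring.
have [q k0k0] := sqr_parity X k0.
clearbody k0; exists (k0 + f1 + (r - q) *: e1); split.
- by rewrite !bformE k0h fh eh; ring.
- by rewrite !bformE k0p fp ep; ring.
- by rewrite !bformE (C e1 k0) (C f1 k0) k0e k0f !hypE k0k0 k0p; lia.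
- by exists e1; rewrite // !bformE k0e !hypE; ring.
Qed.

Lemma image_mulmx n (M : set 'rV[int]_n) (g k : 'M[int]_n) :
  [set v *m k | v in [set v *m g | v in M]] = [set v *m (g *m k) | v in M].
Proof.
apply/seteqP; split=> [_ [_ [y My <-] <-]|_ [y My <-]].
  by exists y; rewrite // mulmxA.
by exists (y *m g); rewrite -?mulmxA //; exists y.
Qed.

Lemma Otilde_orbit_image M g : Otilde X g ->
  Otilde_orbit X [set v *m g | v in M] = Otilde_orbit X M.
Proof.
move=> Og; apply/seteqP; split=> N [k Ok ->].
  by exists (g *m k); [exact: pointwise_stabilizerM | exact: image_mulmx].
exists (invmx g *m k).
  exact/(pointwise_stabilizerM (pointwise_stabilizerV Og)).
by rewrite image_mulmx mulKVmx //; case: Og.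
Qed.

Lemma adjoin_isometry v w g :
  Otilde X g -> v *m g = w -> adjoin w = [set x *m g | x in adjoin v].
Proof.
move=> [_ _ fixg] <-; apply/seteqP.
split=> [y|_ [y /zspan_col_mx1[u Lu [m ->]] <-]].
  move=> /zspan_col_mx1[u Lu [m ->]]; exists (u + m *: v).
    by apply/zspan_col_mx1; exists u => //; exists m.
  by rewrite mulmxDl (fixg u Lu) scalemxAl.
apply/zspan_col_mx1; exists u => //; exists m.
by rewrite mulmxDl (fixg u Lu) scalemxAl.
Qed.

Lemma single_orbit a b c d : 0 < d -> (2 %| c - b)%Z ->
    d = 11 * c - (4 * a ^+ 2 - 14 * a * b + 15 * b ^+ 2) ->
  exists M, [/\ sublattices X d M, orbits X d = [set Otilde_orbit X M]
              & has_gram X M a b c].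
Proof.
move=> d_gt0 parity dE.
have [v [vh vp vv primv]] := exists_vector a parity.
have [subv gramv] := sublattice_of_vector vh vp vv primv d_gt0 dE.
exists (adjoin v); split=> //; apply/seteqP.
split=> [_ [M subM <-]|_ ->]; last by exists (adjoin v).
have [w [-> wh wp ww primw]] := vector_of_sublattice subM dE.
have [e1 [f1 [e2 [f2 [hyp [We1 Wf1 We2 Wf2]]]]]] := Lambda_van_planes X.
have [||g Og vg] := eichler_criterion symG hyp We1 Wf1 We2 Wf2
  (@Lambda_van_even X) (v := v) (w := w) _ _ primv primw.
- by apply/Lambda_vanP; rewrite !bformE vh vp wh wp !subrr.
- by rewrite vv ww.
by rewrite /= (adjoin_isometry Og vg) Otilde_orbit_image.
Qed.
End SpecialSublattices.

(* The divisions by 11 are exact under the congruence that guards them. *)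
Theorem proposition3p9 (X : peskine_H6) (specX : special X) (d : int)
    (d_gt0 : 0 < d)
    (d_mod : [\/ (d = 0 %[mod 22])%Z, (d = 2 %[mod 22])%Z,
                 (d = 6 %[mod 22])%Z
               | [\/ (d = 8 %[mod 22])%Z, (d = 10 %[mod 22])%Z
                   | (d = 18 %[mod 22])%Z]]) :
  exists M : set 'rV[int]_24,
    sublattices X d M /\
    orbits X d = [set Otilde_orbit X M] /\
    ((d = 0 %[mod 22])%Z -> has_gram X M 0 0 (d %/ 11)%Z) /\
    ((d = 2 %[mod 22])%Z -> has_gram X M 3 1 ((d + 9) %/ 11)%Z) /\
    ((d = 6 %[mod 22])%Z -> has_gram X M 1 1 ((d + 5) %/ 11)%Z) /\
    ((d = 8 %[mod 22])%Z -> has_gram X M 2 1 ((d + 3) %/ 11)%Z) /\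
    ((d = 10 %[mod 22])%Z -> has_gram X M 3 2 ((d + 12) %/ 11)%Z) /\
    ((d = 18 %[mod 22])%Z -> has_gram X M 1 0 ((d + 4) %/ 11)%Z).
Proof.
have [a [b [c [dE parity gramE]]]] : exists a b c : int,
  [/\ d = 11 * c - (4 * a ^+ 2 - 14 * a * b + 15 * b ^+ 2),
      (2 %| c - b)%Z
    & forall M, has_gram X M a b c ->
      ((d = 0 %[mod 22])%Z -> has_gram X M 0 0 (d %/ 11)%Z) /\
      ((d = 2 %[mod 22])%Z -> has_gram X M 3 1 ((d + 9) %/ 11)%Z) /\
      ((d = 6 %[mod 22])%Z -> has_gram X M 1 1 ((d + 5) %/ 11)%Z) /\
      ((d = 8 %[mod 22])%Z -> has_gram X M 2 1 ((d + 3) %/ 11)%Z) /\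
      ((d = 10 %[mod 22])%Z -> has_gram X M 3 2 ((d + 12) %/ 11)%Z) /\
      ((d = 18 %[mod 22])%Z -> has_gram X M 1 0 ((d + 4) %/ 11)%Z)].
  case: d_mod => [d_eq|d_eq|d_eq|[d_eq|d_eq|d_eq]];
    [exists 0, 0, (d %/ 11)%Z | exists 3, 1, ((d + 9) %/ 11)%Z
    |exists 1, 1, ((d + 5) %/ 11)%Z | exists 2, 1, ((d + 3) %/ 11)%Z
    |exists 3, 2, ((d + 12) %/ 11)%Z | exists 1, 0, ((d + 4) %/ 11)%Z];
    (split;
     [ by lia
     | by lia
     | move=> M gramM; do 5?[apply: conj] => d_eq';
       by [exact: gramM | exfalso; lia] ]).
have [M [subM orbM gramM]] := single_orbit X d_gt0 parity dE.
by exists M; do 2!split=> //; apply: gramE.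
Qed.
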